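(* Let $n>1$ and $s>1$ be integers and let $k$ be a formally real field. Then $p_{2s}(k[x_1,\dots,x_n])=\infty$.
   Context: For a commutative ring $A$ with identity and a positive integer $m$, the $m$-th Pythagoras number $p_m(A)$ is the least positive integer $\ell$ such that every element of $A$ that is a sum of $m$-th powers of elements of $A$ can be written as a sum of at most $\ell$ $m$-th powers of elements of $A$; if no such $\ell$ exists, $p_m(A)=\infty$. A field is formally real if $-1$ is not a sum of squares in it. *)

(* Defs.v *)
From HB Require Import structures.
From mathcomp Require Import all_boot all_order all_algebra.
From mathcomp Require Import mpoly.
Set Implicit Arguments. Unset Strict Implicit. Unset Printing Implicit Defensive.
Import Order.TTheory GRing.Theory.
Local Open Scope ring_scope.

Definition is_sum_of_powers (A : comPzRingType) (m : nat) (a : A) : Prop :=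
  exists s : seq A, a = \sum_(x <- s) x ^+ m.

Definition is_sum_of_at_most_powers (A : comPzRingType) (m l : nat) (a : A) : Prop :=
  exists s : seq A, (size s <= l)%N /\ a = \sum_(x <- s) x ^+ m.

Definition pythagoras_finite (A : comPzRingType) (m : nat) : Prop :=
  exists l : nat, (0 < l)%N /\
    forall a : A, is_sum_of_powers m a -> is_sum_of_at_most_powers m l a.

Definition pythagoras_infinite (A : comPzRingType) (m : nat) : Prop :=
  ~ pythagoras_finite A m.

Definition formally_real (k : fieldType) : Prop :=
  ~ is_sum_of_powers 2 (-1 : k).

(* Main.v *)
(** Since k[x_1, ..., x_n] surjects onto k[x, y], it suffices to treat k[x, y].
    Put A_j = prod_(u <= d, u != j) (T - u) and f = sum_(j <= d) (A_j(x) A_j(y))^(2s).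
    Suppose f = sum_i g_i^(2s).  On the line y = q, f is a multiple of A_q^(2s), so
    formal reality forces g_i(x, q) to be a scalar multiple of A_q(x); likewise
    g_i(p, y) is a scalar multiple of A_p(y).  Hence every g_i vanishes at the grid
    points (p, q) with p != q, with linear term X_i u + Y_i v there.  Comparing the
    coefficients of u^(2s-2) v^2 (a mixed monomial, as s > 1) in the leading forms
    at (p, q) gives sum_i X_i^(2s-2) Y_i^2 = 0, so X_i Y_i = 0.  Now X_i = 0 iff
    g_i(q, q) = 0 and Y_i = 0 iff g_i(p, p) = 0: each g_i is nonzero at at most one
    point of the diagonal, whereas f is nonzero at all d + 1 of them. *)

Require Import Defs.
From mathcomp Require Import all_boot all_order all_algebra.
From mathcomp Require Import separable mpoly.
Set Implicit Arguments. Unset Strict Implicit. Unset Printing Implicit Defensive.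
Import GRing.Theory.
Local Open Scope ring_scope.

(** Here [d] is only an upper bound for the degree, so that one value can serve a family of
    polynomials of different degrees. *)
Lemma coef_exp_top (R : comNzRingType) (w : {poly R}) d m :
  (size w <= d.+1)%N -> (w ^+ m)`_(m * d) = w`_d ^+ m.
Proof.
move=> sz; elim: m => [|m IH]; first by rewrite mul0n !expr0 coefC.
have szm : (size (w ^+ m) <= (m * d).+1)%N.
  apply: leq_trans (size_poly_exp_leq _ _) _; rewrite ltnS mulnC leq_mul2l.
  by case: (size w) sz => [|j] /=; rewrite ?leq0n ?ltnS => ?; apply/orP; right.
rewrite !exprS mulSn coefM (bigD1 (inord d)) //= inordK ?ltnS ?leq_addr //.
rewrite addnC addnK IH big1 ?addr0 // => i.
rewrite -val_eqE /= inordK ?ltnS ?leq_addl //.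
case: (ltngtP i d) => // ltid _; last by rewrite nth_default ?mul0r ?(leq_trans sz).
rewrite [X in _ * X]nth_default ?mulr0 //.
apply: leq_trans szm _; rewrite ltn_subRL addnC ltn_add2l //.
Qed.

(** * Sums of even powers over a formally real field *)

Section FormallyReal.
Variables (k : fieldType) (realk : formally_real k).

(** If some [F i] were nonzero, dividing by its square would exhibit -1 as a sum of squares of the
    other [F j / F i]. *)
Lemma formally_real_sum_sqr_eq0 (I : eqType) (r : seq I) (F : I -> k) :
  \sum_(i <- r) F i ^+ 2 = 0 -> forall i, i \in r -> F i = 0.
Proof.
move=> sum0 i ir; apply/eqP/negPn/negP => Fi0; apply: realk.
exists [seq F j / F i | j <- rem i r].
rewrite big_map; under eq_bigr do rewrite expr_div_n; rewrite -mulr_suml.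
move: sum0; rewrite (perm_big _ (perm_to_rem ir)) big_cons /=.
by move/eqP; rewrite addrC addr_eq0 => /eqP ->; rewrite mulNr divff ?expf_neq0.
Qed.

Lemma formally_real_sum_expr_eq0 (I : eqType) (r : seq I) (F : I -> k) s :
  (0 < s)%N ->
  \sum_(i <- r) F i ^+ (2 * s) = 0 -> forall i, i \in r -> F i = 0.
Proof.
move=> s_gt0; under eq_bigr do rewrite mulnC exprM.
move=> /formally_real_sum_sqr_eq0 sum0 i /sum0 /eqP.
by rewrite expf_eq0 s_gt0 => /eqP.
Qed.

(** The left side is a sum of squares of ones, and 1 is nonzero. *)
Lemma formally_real_natf_neq0 n : (n.+1%:R : k) != 0.
Proof.
apply/eqP => n0; have := @formally_real_sum_sqr_eq0 _ (iota 0 n.+1) (fun=> 1).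
rewrite (eq_bigr (fun=> 1)) => [|i _]; last by rewrite expr1n.
rewrite big_const_seq count_predT size_iota iter_addr_0 => /(_ n0 0).
by rewrite inE eqxx => /(_ isT)/eqP; rewrite oner_eq0.
Qed.

Lemma formally_real_natr_inj : injective (fun n => n%:R : k).
Proof.
suff lt_neq m n : (m < n)%N -> m%:R != n%:R :> k.
  by move=> m n /eqP; case: (ltngtP m n) => // /lt_neq; rewrite 1?eq_sym => /negPf->.
move=> ltmn; rewrite eq_sym -subr_eq0 -natrB ?(ltnW ltmn) //.
by rewrite -(prednK (n := n - m)) ?subn_gt0 // formally_real_natf_neq0.
Qed.

Lemma formally_real_poly_eq0 (P : {poly k}) :
  (forall n, P.[n%:R] = 0) -> P = 0.
Proof.
move=> P0; apply/eqP/negPn/negP => Pn0.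
have := @max_poly_roots _ P [seq n%:R | n <- iota 0 (size P)] Pn0.
rewrite size_map size_iota ltnn map_inj_uniq ?iota_uniq; last first.
  exact: formally_real_natr_inj.
suff -> : all (root P) [seq n%:R | n <- iota 0 (size P)] by move=> /(_ isT isT).
by apply/allP => _ /mapP[n _ ->]; rewrite /root P0.
Qed.

(** * Sums of even powers of polynomials in one variable *)

(** Leading terms cannot cancel: the coefficients at a common positive degree bound have powers
    summing to zero, so they vanish and the bound drops, down to degree zero. *)
Lemma sum_expr_const (I : eqType) (r : seq I) (w : I -> {poly k}) s c :
  (0 < s)%N -> \sum_(i <- r) w i ^+ (2 * s) = c%:P ->
  forall i, i \in r -> (size (w i) <= 1)%N.
Proof.
move=> s_gt0 sumE.
have [D szD] : exists D, forall i, i \in r -> (size (w i) <= D.+1)%N.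
  exists (\max_(i <- r) size (w i)) => i ir.
  by apply: leqW; apply: (@leq_bigmax_seq _ r xpredT (fun i => size (w i))).
elim: D szD => [//|D IH] szD; apply: IH => i ir.
have top0 : \sum_(j <- r) (w j)`_D.+1 ^+ (2 * s) = 0.
  move/(congr1 (fun P : {poly k} => P`_(2 * s * D.+1))): sumE.
  rewrite coefC !muln_eq0 /= -[s == 0%N]negbK -lt0n s_gt0 /= coef_sum.
  by apply: etrans; apply: eq_big_seq => j jr; rewrite coef_exp_top // szD.
apply/leq_sizeP => j; rewrite leq_eqVlt => /predU1P[<-|ltj].
  exact: (formally_real_sum_expr_eq0 s_gt0 top0).
by rewrite nth_default // (leq_trans (szD i ir)).
Qed.

(** At each root of the product the right side vanishes, hence so does every [u i]; the roots being
    distinct, the whole product divides [u i]. The powers of the quotients sum to [c], so the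
    quotients are constant. *)
Lemma sum_expr_prod_XsubC (I : eqType) (r : seq I) (u : I -> {poly k})
    (rs : seq k) s c :
  (0 < s)%N -> uniq rs ->
  \sum_(i <- r) u i ^+ (2 * s)
    = c *: (\prod_(z <- rs) ('X - z%:P)) ^+ (2 * s) ->
  forall i, i \in r -> exists w, u i = w *: \prod_(z <- rs) ('X - z%:P).
Proof.
move=> s_gt0 urs; set A := \prod_(z <- rs) _ => sumE.
have A0 : A != 0 by rewrite monic_neq0 ?monic_prod_XsubC.
have dvdA i : i \in r -> u i = (u i %/ A) * A.
  move=> ir; rewrite divpK // uniq_roots_dvdp ?uniq_rootsE //.
  apply/allP => z zrs; apply/eqP.
  apply: (formally_real_sum_expr_eq0 (F := fun i => (u i).[z]) s_gt0 _ ir).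
  move/(congr1 (horner^~ z)): sumE; rewrite horner_sum hornerZ horner_exp.
  under eq_bigr do rewrite horner_exp.
  move=> ->; have /eqP-> : root A z by rewrite root_prod_XsubC.
  by rewrite expr0n muln_eq0 /= -[s == 0%N]negbK -lt0n s_gt0 mulr0.
have quoE : \sum_(i <- r) (u i %/ A) ^+ (2 * s) = c%:P.
  apply: (mulIf (expf_neq0 (2 * s) A0)); rewrite mul_polyC -sumE mulr_suml.
  by apply: eq_big_seq => i ir; rewrite {2}(dvdA i ir) exprMn.
move=> i ir; exists (u i %/ A)`_0.
by rewrite {1}(dvdA i ir) (size1_polyC (sum_expr_const s_gt0 quoE ir)) coefC mul_polyC.
Qed.

(** * First-order terms at a common zero *)

(** By the product rule, the quotient of [u i] by X - p takes at p the value of the derivative of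
    [u i]. *)
Lemma sum_expr_deriv (I : eqType) (r : seq I) (u : I -> {poly k}) p m :
  (forall i, i \in r -> root (u i) p) ->
  \sum_(i <- r) u i ^+ m
    = ('X - p%:P) ^+ m * \sum_(i <- r) (u i %/ ('X - p%:P)) ^+ m
  /\ (\sum_(i <- r) (u i %/ ('X - p%:P)) ^+ m).[p]
    = \sum_(i <- r) (u i)^`().[p] ^+ m.
Proof.
move=> u0.
have uE i : i \in r -> u i = (u i %/ ('X - p%:P)) * ('X - p%:P).
  by move=> /u0; rewrite -dvdp_XsubCl => /divpK.
split; first by rewrite mulr_sumr; apply: eq_big_seq => i ir; rewrite {1}uE // exprMn mulrC.
rewrite horner_sum; apply: eq_big_seq => i ir; rewrite horner_exp; congr (_ ^+ m).
rewrite {2}uE // derivM derivXsubC mulr1 hornerD hornerM hornerXsubC subrr mulr0.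
by rewrite add0r.
Qed.

Lemma eq_sum_expr_deriv (I J : eqType) (r : seq I) (t : seq J)
    (u : I -> {poly k}) (v : J -> {poly k}) p m :
  (forall i, i \in r -> root (u i) p) -> (forall j, j \in t -> root (v j) p) ->
  \sum_(i <- r) u i ^+ m = \sum_(j <- t) v j ^+ m ->
  \sum_(i <- r) (u i)^`().[p] ^+ m = \sum_(j <- t) (v j)^`().[p] ^+ m.
Proof.
move=> /(sum_expr_deriv m)[uE u'E] /(sum_expr_deriv m)[vE v'E].
rewrite uE vE => /mulfI eq_quo; rewrite -u'E -v'E eq_quo //.
by rewrite expf_neq0 // polyXsubC_eq0.
Qed.

(* In {poly {poly k}} the inner variable is x and the outer one is y, so g(p, q) is
   g.[q%:P].[p]. *)
Definition dX (g : {poly {poly k}}) (p q : k) := (g.[q%:P])^`().[p].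
Definition dY (g : {poly {poly k}}) (p q : k) := g^`().[q%:P].[p].

(** Chain rule for y = c(x): the first term differentiates the coefficients in x, the second
    accounts for y. *)
Lemma deriv_horner (g : {poly {poly k}}) (c : {poly k}) :
  (g.[c])^`() = (map_poly deriv g).[c] + g^`().[c] * c^`().
Proof.
elim/poly_ind: g => [|g a IH].
  by rewrite !raddf0 !horner0 derivC mul0r addr0.
have -> : map_poly deriv (g * 'X + a%:P) = map_poly deriv g * 'X + (a^`())%:P.
  apply/polyP => i; rewrite coef_map_id0 ?derivC // !coefD !coefMX !coefC.
  by case: i => [|i] /=; rewrite ?add0r ?addr0 // coef_map_id0 ?derivC.
rewrite derivMXaddC !hornerMXaddC derivD derivM hornerD hornerMX IH.
rewrite !mulrDl -!addrA [_ * _ * c]mulrAC; congr (_ + _).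
by rewrite addrA addrC; congr (_ + _); rewrite addrC.
Qed.

Lemma horner_line (g : {poly {poly k}}) p q b :
  g.[q%:P + b *: ('X - p%:P)].[p] = g.[q%:P].[p].
Proof.
elim/poly_ind: g => [|h a IH]; first by rewrite !horner0.
rewrite !hornerMXaddC !(hornerD _ _ p, hornerM _ _ p) IH hornerZ hornerXsubC.
by rewrite subrr mulr0 addr0.
Qed.

Lemma deriv_line (g : {poly {poly k}}) p q b :
  (g.[q%:P + b *: ('X - p%:P)])^`().[p] = dX g p q + b * dY g p q.
Proof.
rewrite /dX /dY !deriv_horner derivC mulr0 addr0 derivD derivC add0r derivZ.
rewrite derivXsubC hornerD hornerM hornerZ hornerC mulr1 !horner_line.
by rewrite mulrC.
Qed.

Lemma coef2_exp_linear (a b : k) m :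
  ((a%:P + b *: 'X) ^+ m)`_2 = a ^+ (m - 2) * b ^+ 2 *+ 'C(m, 2).
Proof.
rewrite exprDn coef_sum.
have coefE i : ((a%:P ^+ (m - i) * (b *: 'X) ^+ i) *+ 'C(m, i))`_2
    = (a ^+ (m - i) * b ^+ i *+ 'C(m, i)) *+ (i == 2).
  rewrite coefMn -polyC_exp exprZn mul_polyC !coefZ coefXn eq_sym.
  by case: (i == 2); rewrite ?mulr1 // !mulr0 mul0rn.
under eq_bigr do rewrite coefE.
case: (ltnP 2 m.+1) => [lt2|le2].
  rewrite (bigD1 (Ordinal lt2)) //= big1 ?addr0 ?mulr1n // => i.
  by rewrite -val_eqE /= => /negPf ->.
rewrite bin_small // big1 // => i _.
by rewrite ltn_eqF // (leq_trans (ltn_ord i)).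
Qed.

(* The leading forms at (p, q) are compared along the lines y = q + n (x - p), n : nat. *)
Lemma eq_sum_expr_dX_dY (I : eqType) (r : seq I)
    (gs : seq {poly {poly k}}) (h : I -> {poly {poly k}}) p q s :
  (1 < s)%N ->
  (forall g, g \in gs -> g.[q%:P].[p] = 0) ->
  (forall i, i \in r -> (h i).[q%:P].[p] = 0) ->
  (forall i, i \in r -> dX (h i) p q * dY (h i) p q = 0) ->
  \sum_(g <- gs) g ^+ (2 * s) = \sum_(i <- r) h i ^+ (2 * s) ->
  forall g, g \in gs -> dX g p q * dY g p q = 0.
Proof.
move=> s_gt1 g0 h0 hXY sumE g gin.
(* The linear part of [f] at (p, q) with u = 1 and v = T: leading forms become polynomials in the
   slope T. *)
pose P (f : {poly {poly k}}) := (dX f p q)%:P + dY f p q *: 'X.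
have lineE : \sum_(f <- gs) P f ^+ (2 * s) = \sum_(i <- r) P (h i) ^+ (2 * s).
  apply/eqP; rewrite -subr_eq0; apply/eqP; apply: formally_real_poly_eq0 => n.
  rewrite hornerD hornerN !horner_sum; apply/eqP; rewrite subr_eq0; apply/eqP.
  have PE f : (P f ^+ (2 * s)).[n%:R] =
      (f.[q%:P + n%:R *: ('X - p%:P)])^`().[p] ^+ (2 * s).
    by rewrite horner_exp deriv_line /P hornerD hornerC hornerZ hornerX [_ * n%:R]mulrC.
  under eq_bigr do rewrite PE; under [RHS]eq_bigr do rewrite PE.
  apply: eq_sum_expr_deriv => [f fin|i ir|].
  - by rewrite /root horner_line g0.
  - by rewrite /root horner_line h0.
  move/(congr1 (horner^~ (q%:P + n%:R *: ('X - p%:P)))): sumE.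
  by rewrite !horner_sum; under eq_bigr do rewrite horner_exp;
     under [RHS]eq_bigr do rewrite horner_exp.
have sm : (2 * s - 2 = 2 * s.-1)%N by rewrite -subn1 mulnBr.
(* As s > 1, the exponent 2s - 2 is positive, so X really occurs in the coefficient of T^2. *)
have s1_gt0 : (0 < s.-1)%N by case: (s) s_gt1 => [|[]].
have C_neq0 : ('C(2 * s, 2)%:R : k) != 0.
  rewrite -(prednK (n := 'C(2 * s, 2))) ?formally_real_natf_neq0 //.
  by rewrite bin_gt0 (@leq_pmulr 2 s) // ltnW.
move/(congr1 (fun Q : {poly k} => Q`_2)): lineE.
rewrite !coef_sum; under eq_bigr do rewrite coef2_exp_linear.
under [RHS]eq_bigr do rewrite coef2_exp_linear.
rewrite sm [RHS]big1_seq => [|i /= ir]; last first.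
  apply/eqP; rewrite -mulr_natr !mulf_eq0 !expf_eq0 muln_gt0 s1_gt0 /=.
  by have /eqP := hXY i ir; rewrite mulf_eq0 orbA => ->.
(* The coefficient is, up to a nonzero binomial factor, the square of X^(s-1) Y, so formal reality
   applies to it. *)
have sqE f : dX f p q ^+ (2 * s.-1) * dY f p q ^+ 2 *+ 'C(2 * s, 2)
    = (dX f p q ^+ s.-1 * dY f p q) ^+ 2 * 'C(2 * s, 2)%:R.
  by rewrite exprMn -exprM mulnC mulr_natr.
under eq_bigr do rewrite sqE; rewrite -mulr_suml => /eqP.
rewrite mulf_eq0 (negPf C_neq0) orbF => /eqP /formally_real_sum_sqr_eq0.
by move=> /(_ g gin)/eqP; rewrite mulf_eq0 expf_eq0 s1_gt0 /= -mulf_eq0 => /eqP.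
Qed.

(** * The polynomials A_j and their products on the grid *)

Definition nodes d j : seq k := [seq i%:R | i <- iota 0 d.+1 & i != j].
(** For j <= d this is the Lagrange basis polynomial of the nodes 0, ..., d, without
    normalisation. *)
Definition node_poly d j : {poly k} := \prod_(z <- nodes d j) ('X - z%:P).
(** The first factor is A_j in the inner variable x; [map_poly polyC] moves the second to the outer
    variable y. *)
Definition diag_poly d j : {poly {poly k}} :=
  (node_poly d j)%:P * map_poly polyC (node_poly d j).

Lemma uniq_nodes d j : uniq (nodes d j).
Proof.
by rewrite map_inj_uniq ?filter_uniq ?iota_uniq //; apply: formally_real_natr_inj.
Qed.

Lemma node_poly_eq0 d j i : (i <= d)%N ->
  ((node_poly d j).[i%:R] == 0) = (i != j).
Proof.
move=> lid; rewrite -[LHS]/(root _ _) root_prod_XsubC mem_map; last first.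
  exact: formally_real_natr_inj.
by rewrite mem_filter mem_iota add0n /= ltnS lid andbT.
Qed.

(** The roots are distinct, hence simple. *)
Lemma node_poly_deriv_neq0 d j i : (i <= d)%N -> i != j ->
  (node_poly d j)^`().[i%:R] != 0.
Proof.
move=> lid neq; have := node_poly_eq0 j lid; rewrite neq => A0.
have sepA : separable_poly (node_poly d j) by rewrite separable_prod_XsubC uniq_nodes.
by move: sepA; rewrite unlock => /coprimep_root; apply; rewrite /root A0.
Qed.

Lemma diag_poly_hornerX d j i :
  (diag_poly d j).[i%:P] = (node_poly d j).[i] *: node_poly d j.
Proof. by rewrite hornerM hornerC horner_map mulrC mul_polyC. Qed.

Lemma diag_poly_hornerY d j i :
  map_poly (horner_eval i) (diag_poly d j) = (node_poly d j).[i] *: node_poly d j.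
Proof.
rewrite rmorphM /= map_polyC /= -map_poly_comp map_poly_id ?mul_polyC // => x _.
by rewrite /= horner_evalE hornerC.
Qed.

Lemma horner_hornerY (g : {poly {poly k}}) p q :
  (map_poly (horner_eval p) g).[q] = g.[q%:P].[p].
Proof. by rewrite -[RHS]/(horner_eval p _) -horner_map /= horner_evalE hornerC. Qed.

Lemma dYE (g : {poly {poly k}}) p q :
  dY g p q = (map_poly (horner_eval p) g)^`().[q].
Proof. by rewrite deriv_map horner_hornerY. Qed.

(** On the line y = i the factor A_j(i) kills every term but j = i. The summands are symmetric in x
    and y, so the value also serves for x = i. *)
Lemma sum_expr_diag_polyX d i s : (0 < s)%N -> (i <= d)%N ->
  \sum_(j <- iota 0 d.+1) (diag_poly d j).[i%:R%:P] ^+ (2 * s)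
    = (node_poly d i).[i%:R] ^+ (2 * s) *: node_poly d i ^+ (2 * s).
Proof.
move=> s_gt0 lid; rewrite (bigD1_seq i) ?iota_uniq ?mem_iota ?add0n ?ltnS //=.
rewrite big1 ?addr0 => [|j neq]; first by rewrite diag_poly_hornerX exprZn.
have /eqP A0 : (node_poly d j).[i%:R] == 0 by rewrite node_poly_eq0 // eq_sym.
by rewrite diag_poly_hornerX A0 scale0r expr0n muln_eq0 /= gtn_eqF.
Qed.

(** The two derivatives carry the factors A_j(q) and A_j(p), and j cannot equal both q and p. *)
Lemma diag_poly_dXY_eq0 d j p q : (p <= d)%N -> (q <= d)%N -> p != q ->
  dX (diag_poly d j) p%:R q%:R * dY (diag_poly d j) p%:R q%:R = 0.
Proof.
move=> lpd lqd neq; apply/eqP.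
rewrite dYE /dX diag_poly_hornerX diag_poly_hornerY !derivZ !hornerZ !mulf_eq0.
rewrite !node_poly_eq0 //; case: (q =P j) neq => //= <- ->.
by rewrite orbT.
Qed.

Lemma diag_poly_horner2_eq0 d j p q : (p <= d)%N -> (q <= d)%N -> p != q ->
  (diag_poly d j).[q%:R%:P].[p%:R] = 0.
Proof.
move=> lpd lqd neq; apply/eqP; rewrite diag_poly_hornerX hornerZ mulf_eq0.
by rewrite !node_poly_eq0 //; case: (q =P j) neq => //= <- ->.
Qed.

(** * Lower bound on the number of powers *)

Section Representation.
Variables (s d : nat) (gs : seq {poly {poly k}}).
Hypothesis s_gt1 : (1 < s)%N.
Hypothesis sumE : \sum_(g <- gs) g ^+ (2 * s)
  = \sum_(j <- iota 0 d.+1) diag_poly d j ^+ (2 * s).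

Let s_gt0 : (0 < s)%N := ltnW s_gt1.

Lemma representation_sum_hornerX q : (q <= d)%N ->
  \sum_(g <- gs) g.[q%:R%:P] ^+ (2 * s)
    = (node_poly d q).[q%:R] ^+ (2 * s) *: node_poly d q ^+ (2 * s).
Proof.
move=> lqd; rewrite -sum_expr_diag_polyX //.
move/(congr1 (horner^~ q%:R%:P)): sumE; rewrite !horner_sum.
by under eq_bigr do rewrite horner_exp; under [RHS]eq_bigr do rewrite horner_exp.
Qed.

Lemma representation_hornerX g q : g \in gs -> (q <= d)%N ->
  exists w, g.[q%:R%:P] = w *: node_poly d q.
Proof.
move=> gin lqd.
apply: (sum_expr_prod_XsubC (u := fun g => g.[q%:R%:P])
  (c := (node_poly d q).[q%:R] ^+ (2 * s)) s_gt0 (uniq_nodes d q) _ gin).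
exact: representation_sum_hornerX.
Qed.

Lemma representation_hornerY g p : g \in gs -> (p <= d)%N ->
  exists w, map_poly (horner_eval p%:R) g = w *: node_poly d p.
Proof.
move=> gin lpd.
apply: (sum_expr_prod_XsubC (u := fun g => map_poly (horner_eval p%:R) g)
  (c := (node_poly d p).[p%:R] ^+ (2 * s)) s_gt0 (uniq_nodes d p) _ gin).
rewrite -sum_expr_diag_polyX //.
move/(congr1 (map_poly (horner_eval p%:R))): sumE; rewrite !rmorph_sum /=.
under eq_bigr do rewrite rmorphXn /=; move=> ->; apply: eq_bigr => j _.
by rewrite rmorphXn /= diag_poly_hornerY diag_poly_hornerX.
Qed.

(** If p and q differ, the derivatives at (p, q) are w A_q'(p) and w' A_p'(q), where w and w' are
    nonzero because g is nonzero at (q, q) and (p, p). Simplicity of the roots makes both nonzero,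
    against their product being zero. *)
Lemma representation_diag_inj g p q : g \in gs -> (p <= d)%N -> (q <= d)%N ->
  g.[p%:R%:P].[p%:R] != 0 -> g.[q%:R%:P].[q%:R] != 0 -> p = q.
Proof.
move=> gin lpd lqd gp gq; apply/eqP/negPn/negP => neq.
have g0 f : f \in gs -> f.[q%:R%:P].[p%:R] = 0.
  move=> /representation_hornerX/(_ lqd)[w ->]; apply/eqP.
  by rewrite hornerZ mulf_eq0 node_poly_eq0 // neq orbT.
have := eq_sum_expr_dX_dY s_gt1 g0 _ _ sumE gin.
move=> /(_ (fun j _ => diag_poly_horner2_eq0 j lpd lqd neq)).
move=> /(_ (fun j _ => diag_poly_dXY_eq0 j lpd lqd neq)) /eqP.
rewrite -horner_hornerY in gp; rewrite dYE /dX.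
have [w gX] := representation_hornerX gin lqd.
have [w' gY] := representation_hornerY gin lpd.
move: gp gq; rewrite gX gY !derivZ !hornerZ !mulf_eq0 !negb_or.
move=> /andP[/negPf-> _] /andP[/negPf-> _] /=.
by rewrite !(negPf (node_poly_deriv_neq0 _ _)) // eq_sym.
Qed.

(** Every diagonal point is a nonzero of some summand, and different points need different
    summands. *)
Lemma representation_size : (d < size gs)%N.
Proof.
have hit j : (j <= d)%N -> has (fun g => g.[j%:R%:P].[j%:R] != 0) gs.
  move=> ljd; apply/hasPn => nohit.
  move/(congr1 (horner^~ j%:R)): (representation_sum_hornerX ljd).
  rewrite horner_sum big1_seq => [|g /= gin]; last first.
    move/nohit: gin; rewrite negbK => /eqP g0.
    by rewrite horner_exp g0 expr0n muln_eq0 /= gtn_eqF.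
  move/esym/eqP; rewrite hornerZ horner_exp mulf_eq0 !expf_eq0.
  by rewrite node_poly_eq0 // eqxx !andbF.
pose G j := nth 0 gs (find (fun g => g.[j%:R%:P].[j%:R] != 0) gs).
have Gin j : (j <= d)%N -> G j \in gs by move=> /hit; rewrite has_find; apply: mem_nth.
have Gneq0 j : (j <= d)%N -> (G j).[j%:R%:P].[j%:R] != 0.
  by move=> /hit /(nth_find 0).
have := @uniq_leq_size _ (map G (iota 0 d.+1)) gs.
rewrite size_map size_iota; apply.
  rewrite map_inj_in_uniq ?iota_uniq // => i j.
  rewrite !mem_iota !add0n /= !ltnS => lid ljd eqG.
  by apply: (representation_diag_inj (Gin i lid)); rewrite ?Gneq0 // eqG Gneq0.
by move=> g /mapP[j]; rewrite mem_iota add0n /= ltnS => /Gin Gj ->.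
Qed.

End Representation.

End FormallyReal.

(** * Infinite Pythagoras numbers in two and in n variables *)

Lemma poly2_pythagoras_infinite (k : fieldType) s :
  (1 < s)%N -> formally_real k -> pythagoras_infinite {poly {poly k}} (2 * s).
Proof.
move=> s_gt1 realk [l [_ fin]].
(* Taking d = l gives l + 1 diagonal points, one more than l powers can cover. *)
have [|gs [szgs /esym sumE]] := fin (\sum_(j <- iota 0 l.+1) diag_poly k l j ^+ (2 * s)).
  by exists [seq diag_poly k l j | j <- iota 0 l.+1]; rewrite big_map.
by have := representation_size realk s_gt1 sumE; rewrite ltnNge szgs.
Qed.

(** A sum of powers is lifted, shortened upstairs and mapped back, so the same bound works. *)
Lemma pythagoras_finite_surj (A B : comPzRingType) (phi : {rmorphism A -> B}) m :
  (forall b, exists a, phi a = b) -> pythagoras_finite A m -> pythagoras_finite B m.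
Proof.
move=> surj [l [l_gt0 fin]]; exists l; split=> // b [t ->].
have [t' ->] : exists t', t = map phi t'.
  elim: t => [|x t [t' ->]]; first by exists [::].
  by have [y <-] := surj x; exists (y :: t').
have [|u [szu sumE]] := fin (\sum_(x <- t') x ^+ m); first by exists t'.
exists (map phi u); rewrite size_map; split=> //.
rewrite !big_map; under eq_bigr do rewrite -rmorphXn.
by rewrite -rmorph_sum sumE rmorph_sum; apply: eq_bigr => i _; rewrite rmorphXn.
Qed.

Lemma mpoly_poly2_surj (k : fieldType) n : (1 < n)%N ->
  exists phi : {rmorphism {mpoly k[n]} -> {poly {poly k}}},
    forall b, exists a, phi a = b.
Proof.
move=> n_gt1.
(* The first indeterminate goes to x and all others to y, so the first two already reach both
   generators. *)
pose h (i : 'I_n) : {poly {poly k}} := if val i == 0%N then 'X%:P else 'X.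
exists (mmap (polyC \o polyC) h).
pose im b := exists a, mmap (polyC \o polyC) h a = b.
have imD b c : im b -> im c -> im (b + c).
  by move=> [x <-] [y <-]; exists (x + y); rewrite rmorphD.
have imM b c : im b -> im c -> im (b * c).
  by move=> [x <-] [y <-]; exists (x * y); rewrite rmorphM.
have imC c : im c%:P%:P by exists c%:MP; rewrite mmapC.
have imX : im 'X by exists 'X_(Ordinal n_gt1); rewrite mmapX mmap1U.
have imXP : im 'X%:P by exists 'X_(Ordinal (ltnW n_gt1)); rewrite mmapX mmap1U.
have imP (c : {poly k}) : im c%:P.
  elim/poly_ind: c => [|c a IH]; first exact: imC.
  by rewrite polyCD polyCM; apply: imD (imM _ _ IH imXP) (imC a).
move=> b; change (im b); elim/poly_ind: b => [|b c IH]; first exact: (imP 0).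
exact: imD (imM _ _ IH imX) (imP c).
Qed.

Theorem mainTheorem2 (n s : nat) (k : fieldType) :
  (1 < n)%N -> (1 < s)%N -> formally_real k ->
  pythagoras_infinite {mpoly k[n]} (2 * s).
Proof.
move=> n_gt1 s_gt1 realk fin; have [phi surj] := mpoly_poly2_surj k n_gt1.
exact: poly2_pythagoras_infinite s_gt1 realk (pythagoras_finite_surj surj fin).
Qed.
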